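(* Let $n\ge 1$, let $A$ be a compact set in $\mathbb{R}^n$ and let $k$ be a positive integer with $k\ge c(A)$. Then $$d\left(A(k+1)\right)\le\frac{k}{k+1}\,d\left(A(k)\right).$$
   Context: For a compact set $A\subset\mathbb{R}^n$ and a positive integer $k$, the Minkowski average is $$A(k) = \left\{\frac{a_1+\cdots+a_k}{k} : a_1,\ldots,a_k\in A\right\}.$$ $\mathrm{conv}(A)$ is the convex hull of $A$, and for sets $A,B\subset\mathbb{R}^n$ and $\lambda\ge 0$, $A+\lambda B = \{a+\lambda b : a\in A,\ b\in B\}$. Schneider's non-convexity index of a compact set $A\subset\mathbb{R}^n$ is $$c(A) = \inf\{\lambda\ge 0 : A+\lambda\,\mathrm{conv}(A)\text{ is convex}\}.$$ The Hausdorff distance between a compact set $A\subset\mathbb{R}^n$ and its convex hull is $$d(A) = \inf\{r>0 : \mathrm{conv}(A)\subset A+rB_2^n\},$$ where $B_2^n$ is the closed Euclidean unit ball of $\mathbb{R}^n$. *)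

(* Defs.v *)
From mathcomp Require Import all_boot all_order all_algebra.
From mathcomp Require Import all_classical all_reals all_analysis.

Set Implicit Arguments.
Unset Strict Implicit.
Unset Printing Implicit Defensive.

Import Order.TTheory GRing.Theory Num.Theory.
Import numFieldNormedType.Exports.

Local Open Scope classical_set_scope.
Local Open Scope ring_scope.

(* R^n is 'rV[R]_n. Its library topology is the product topology, which is the
   Euclidean one, so that the library's `compact` is usual compactness. The
   library norm `|x| on 'rV[R]_n is the sup norm, hence the definition of the
   Euclidean norm below. *)

Definition enorm (R : realType) (n : nat) (x : 'rV[R]_n) : R :=
  Num.sqrt (\sum_(i < n) x ord0 i ^+ 2).

Definition eunit_ball (R : realType) (n : nat) : set 'rV[R]_n :=
  [set x | enorm x <= 1].
Arguments eunit_ball : clear implicits.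

Definition conv_hull (R : realType) (n : nat) (A : set 'rV[R]_n) :
    set 'rV[R]_n :=
  smallest (@convex_set R 'rV[R]_n) A.

(* A + lambda B *)
Definition sum_scale (R : realType) (n : nat)
    (A : set 'rV[R]_n) (lambda : R) (B : set 'rV[R]_n) : set 'rV[R]_n :=
  [set a + lambda *: b | a in A & b in B].

(* A(k); meaningful only for 0 < k. *)
Definition mink_avg (R : realType) (n : nat) (A : set 'rV[R]_n) (k : nat) :
    set 'rV[R]_n :=
  [set k%:R^-1 *: (\sum_(i < k) a i) | a in [set a : 'I_k -> 'rV[R]_n |
                                             forall i, A (a i)]].

(* c(A) and d(A) are infima in the extended reals, so that the infimum of the
   empty set would be +oo rather than a default real number. *)

Definition schneider_index (R : realType) (n : nat) (A : set 'rV[R]_n) :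
    \bar R :=
  ereal_inf [set lambda%:E | lambda in
    [set lambda : R | 0 <= lambda /\
       @convex_set R 'rV[R]_n (sum_scale A lambda (conv_hull A))]].

Definition hausdorff_to_hull (R : realType) (n : nat) (A : set 'rV[R]_n) :
    \bar R :=
  ereal_inf [set r%:E | r in
    [set r : R | 0 < r /\ conv_hull A `<=` sum_scale A r (eunit_ball R n)]].

(* Main.v *)
Require Import Defs.
From mathcomp Require Import all_boot all_order all_algebra.
From mathcomp Require Import all_classical all_reals all_analysis.
From mathcomp Require Import ring lra.

Set Implicit Arguments.
Unset Strict Implicit.
Unset Printing Implicit Defensive.

Import Order.TTheory GRing.Theory Num.Theory.
Import numFieldNormedType.Exports.
Local Open Scope ring_scope.

(** Put [H := conv_hull A] and [B := eunit_ball R n].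

    If [A + lambda H] is convex, then it contains [(1 + lambda) H]: the points
    [x] with [(1 + lambda) x] in [A + lambda H] form a convex set containing
    [A]. This persists for every [mu >= lambda], because the surplus
    [(mu - lambda) x] can be absorbed into the hull term
    ([conv_hull_decomposition]). So if [k >= c(A)], every [x] in [H] satisfies
    [(k + 1) x = a + k y] with [a] in [A] and [y] in [H], up to an error
    discussed below. Since [A] is contained in [A(k)], the point [y] lies in
    the hull of [A(k)], hence [y = z + r b] with [z] in [A(k)] and [b] in [B]
    as soon as [r] is admissible in the definition of [d(A(k))]. Then

      [x = (a + k z) / (k + 1) + (k r / (k + 1)) b],

    and [a + k z] is a sum of [k + 1] points of [A]. As the hull of [A(k + 1)]
    lies in [H], the radius [k r / (k + 1)] is admissible for [d(A(k + 1))].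

    When [c(A) = k], the infimum [c(A)] could a priori fail to be attained, so
    the decomposition is used for some [mu = k + delta] with [delta >= 0] small
    ([schneider_index_decomposition]). It then reads
    [(k + 1) x = a + k y + delta (y - x)]; boundedness of [A] bounds [y - x],
    the last term costs an arbitrarily small increase of the radius
    ([mink_avg_radius]), and the inequality survives in the limit. *)

(** * Convex sets in a module *)

Section Convexity.
Context (R : realType) (M : lmodType R).
Implicit Types (C : set M) (x y : M).

Lemma convex_setP C : @convex_set R M C <->
  forall x y (t : R), C x -> C y -> 0 <= t -> t <= 1 ->
    C (t *: x + (1 - t) *: y).
Proof.
split=> [cC x y t Cx Cy t0 t1|cC x y t].
  by have := cC x y (Itv01 t0 t1); rewrite !inE; apply.
by rewrite !inE => Cx Cy; apply: cC.
Qed.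

(** The form of convexity in which dilates add up, [a C + b C = (a + b) C]. *)
Lemma convex_set_scaleD C : @convex_set R M C ->
  forall (a b : R) x y, 0 <= a -> 0 <= b -> C x -> C y ->
  exists2 z, C z & a *: x + b *: y = (a + b) *: z.
Proof.
move=> /convex_setP cC a b x y a0 b0 Cx Cy.
have [ab0|ab0] := eqVneq (a + b) 0.
  have -> : a = 0 by lra.
  have -> : b = 0 by lra.
  by exists x => //; rewrite addr0 !scale0r addr0.
have abgt0 : 0 < a + b by rewrite lt_def ab0 addr_ge0.
exists (a / (a + b) *: x + (1 - a / (a + b)) *: y).
  by apply: cC; rewrite ?divr_ge0 ?addr_ge0 // ler_pdivrMr // mul1r lerDl.
by rewrite scalerDr !scalerA; congr (_ *: _ + _ *: _); field.
Qed.

Lemma convex_set_scale_preimage C (c : R) :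
  @convex_set R M C -> @convex_set R M [set x | C (c *: x)]%classic.
Proof.
move=> /convex_setP cC; apply/convex_setP => x y t /= Cx Cy t0 t1.
by rewrite scalerDr !scalerA ![c * _]mulrC -!scalerA; apply: cC.
Qed.

Lemma convex_set_sum C (k : nat) (F : 'I_k -> M) x :
  @convex_set R M C -> C x -> (forall i, C (F i)) ->
  exists2 z, C z & \sum_(i < k) F i = k%:R *: z.
Proof.
move=> cC Cx; elim: k F => [|k IH] F CF.
  by exists x => //; rewrite big_ord0 scale0r.
have [z Cz ez] := IH _ (fun i => CF (lift ord0 i)).
rewrite big_ord_recl ez -[F ord0]scale1r -nat1r.
exact: convex_set_scaleD.
Qed.

End Convexity.

(** * The Euclidean unit ball *)

Section UnitBall.
Context (R : realType) (n : nat).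
Implicit Types x : 'rV[R]_n.
Local Notation B := (eunit_ball R n).

Lemma eunit_ballE x : B x <-> \sum_(i < n) x ord0 i ^+ 2 <= 1.
Proof.
by rewrite /eunit_ball /enorm /= -[X in _ <= X]sqrtr1 ler_sqrt // ler01.
Qed.

Lemma eunit_ball0 : B 0.
Proof. by apply/eunit_ballE; rewrite big1 // => i _; rewrite mxE expr0n. Qed.

Lemma eunit_ballN x : B x -> B (- x).
Proof.
move=> /eunit_ballE Bx; apply/eunit_ballE.
by rewrite (eq_bigr (fun i => x ord0 i ^+ 2)) // => i _; rewrite mxE sqrrN.
Qed.

(** Convexity of the squaring function gives this coordinatewise, without the
    triangle inequality for [enorm]. *)
Lemma convex_eunit_ball : @convex_set R 'rV[R]_n B.
Proof.
apply/convex_setP => x y t /eunit_ballE Bx /eunit_ballE By t0 t1.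
apply/eunit_ballE.
have le1 : \sum_(i < n) (t *: x + (1 - t) *: y) ord0 i ^+ 2 <=
    \sum_(i < n) (t * x ord0 i ^+ 2 + (1 - t) * y ord0 i ^+ 2).
  apply: ler_sum => i _; rewrite !mxE -subr_ge0.
  rewrite [leRHS](_ : _ = t * (1 - t) * (x ord0 i - y ord0 i) ^+ 2); last by ring.
  by rewrite mulr_ge0 ?sqr_ge0 // mulr_ge0 ?subr_ge0.
apply: le_trans le1 _; rewrite big_split -!mulr_sumr /=.
have := ler_wpM2l t0 Bx; have t1' : 0 <= 1 - t by lra.
have := ler_wpM2l t1' By; lra.
Qed.

Lemma scale_eunit_ball_le (c r : R) x : 0 <= c <= r -> B x ->
  exists2 b, B b & c *: x = r *: b.
Proof.
move=> /andP[c0 cr] Bx; have rc0 : 0 <= r - c by lra.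
have [b Bb e] := convex_set_scaleD convex_eunit_ball c0 rc0 Bx eunit_ball0.
by exists b => //; rewrite -[c *: x]addr0 -(scaler0 _ (r - c)) e addrC subrK.
Qed.

Lemma bounded_sub_eunit_ball (A : set 'rV[R]_n) : bounded_set A ->
  exists2 s : R, 0 < s & forall x, A x -> B (s^-1 *: x).
Proof.
move=> [N [Nreal NA]].
pose m := Num.max N 0 + 1.
have m0 : 0 < m by rewrite ltr_wpDl // le_max lexx orbT.
have Am x : A x -> `|x| <= m.
  by apply: NA; rewrite ltr_pwDr // le_max lexx.
have n0 : 0 < n.+1%:R :> R by rewrite ltr0n.
have s0 : 0 < n.+1%:R * m by rewrite mulr_gt0.
(* Each coordinate of the rescaled point is at most [1 / (n + 1)] in absolute
   value, so its square is too and the [n] squares add up to at most [1]. *)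
exists (n.+1%:R * m) => // x /Am xm; apply/eunit_ballE.
have le1 : \sum_(i < n) ((n.+1%:R * m)^-1 *: x) ord0 i ^+ 2 <=
    \sum_(i < n) (n.+1%:R^-1 : R).
  apply: ler_sum => i _; rewrite mxE.
  have xi : `|x ord0 i| <= m.
    apply: le_trans xm; rewrite [`|x|]mx_normrE.
    exact: (le_bigmax _ (fun ij => `|x ij.1 ij.2|) (ord0, i)).
  have -> : ((n.+1%:R * m)^-1 * x ord0 i) ^+ 2 =
     n.+1%:R^-1 * (n.+1%:R^-1 * (x ord0 i / m) ^+ 2).
    by field; rewrite ?gt_eqF.
  rewrite ler_piMr ?invr_ge0 ?ler0n // mulr_ile1 ?invr_ge0 ?ler0n ?sqr_ge0 //.
    by rewrite invf_le1 // ler1n.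
  rewrite -real_normK ?num_real // normrM normfV (gtr0_norm m0).
  by apply: exprn_ile1; rewrite ?divr_ge0 ?(ltW m0) // ler_pdivrMr // mul1r.
apply: le_trans le1 _; rewrite sumr_const card_ord -[X in X <= _]mulr_natl.
by rewrite ler_pdivrMr // mul1r ler_nat.
Qed.

End UnitBall.

(** * Convex hulls and Minkowski averages *)

Section HullAverage.
Context (R : realType) (n : nat) (A : set 'rV[R]_n).
Local Notation H := (conv_hull A).

Lemma convex_conv_hull : @convex_set R 'rV[R]_n H.
Proof.
apply/convex_setP => x y t Hx Hy t0 t1 C [cC AC].
by move/convex_setP: (cC); apply => //; [apply: Hx|apply: Hy].
Qed.

Lemma sub_mink_avg (k : nat) : (0 < k)%N -> (A `<=` mink_avg A k)%classic.
Proof.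
move=> k0 a Aa; exists (fun=> a) => //.
rewrite sumr_const card_ord -(scaler_nat k a) scalerA mulVf ?scale1r //.
by rewrite pnatr_eq0 -lt0n.
Qed.

Lemma mink_avg_sub_conv_hull (k : nat) : (0 < k)%N ->
  (mink_avg A k `<=` H)%classic.
Proof.
move=> k0 _ [a /= Aa <-].
have Ha i : H (a i) by apply: sub_gen_smallest.
have [z Hz ->] := convex_set_sum convex_conv_hull (Ha (Ordinal k0)) Ha.
by rewrite scalerA mulVf ?scale1r // pnatr_eq0 -lt0n.
Qed.

Lemma mink_avgS (k : nat) (a z : 'rV[R]_n) : (0 < k)%N ->
  A a -> mink_avg A k z -> mink_avg A k.+1 (k.+1%:R^-1 *: (a + k%:R *: z)).
Proof.
move=> k0 Aa [b /= Ab <-].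
exists (fun i => if unlift ord0 i is Some j then b j else a) => [i|].
  by case: unliftP.
rewrite big_ord_recl unlift_none; congr (_ *: (_ + _)).
rewrite scalerA divff ?scale1r ?pnatr_eq0 -?lt0n //.
by apply: eq_bigr => i _; rewrite liftK.
Qed.

(** The points [x] with [(1 + lambda) x] in [A + lambda H] form a convex set
    containing [A], hence all of [H]. For larger [mu], add [(mu - lambda) x] on
    both sides and merge it with the hull term. *)
Lemma conv_hull_decomposition (lambda mu : R) (x : 'rV[R]_n) :
  0 <= lambda <= mu ->
  @convex_set R 'rV[R]_n (sum_scale A lambda H) -> H x ->
  exists2 a, A a & exists2 y, H y & (1 + mu) *: x = a + mu *: y.
Proof.
move=> /andP[l0 lm] cS Hx.
have [a Aa [y Hy exy]] : sum_scale A lambda H ((1 + lambda) *: x).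
  have AS : (A `<=` [set y | sum_scale A lambda H ((1 + lambda) *: y)])%classic.
    move=> a Aa; exists a => //; exists a; first exact: sub_gen_smallest.
    by rewrite scalerDl scale1r.
  exact: (smallest_sub (convex_set_scale_preimage cS) AS).
have ml0 : 0 <= mu - lambda by lra.
have [z Hz ez] := convex_set_scaleD convex_conv_hull l0 ml0 Hy Hx.
exists a => //; exists z => //.
move: ez; rewrite [lambda + _]addrC subrK => <-.
by rewrite addrA exy -scalerDl; congr (_ *: _); ring.
Qed.

(** Applying the previous lemma with [mu = k + d], the part of the identity
    proportional to [d] is isolated as an error term, so that the coefficients
    are those of an average of [k + 1] points. *)
Lemma schneider_index_decomposition (k e : R) (x : 'rV[R]_n) :
  (schneider_index A <= k%:E)%E -> 0 < e -> H x ->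
  exists2 d : R, 0 <= d <= e &
  exists2 a, A a & exists2 y, H y &
    (1 + k) *: x = a + k *: y + d *: (y - x).
Proof.
move=> ck e0 Hx.
have [_ [l [l0 cS] <-]] : exists2 y, [set lambda%:E | lambda in
    [set lambda : R | 0 <= lambda /\
       @convex_set R 'rV[R]_n (sum_scale A lambda H)]]%classic y &
    (y < (k + e)%:E)%E.
  by apply: ereal_inf_lt; apply: le_lt_trans ck _; rewrite lte_fin ltrDl.
rewrite lte_fin => lke.
pose d := Num.max 0 (l - k).
have lkd : 0 <= l <= k + d.
  by rewrite l0 /= -lerBlDl /d le_max lexx orbT.
have [a Aa [y Hy exy]] := conv_hull_decomposition lkd cS Hx.
exists d; first by rewrite /d le_max lexx ge_max (ltW e0) /=; lra.
exists a => //; exists y => //.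
apply/rowP => i; move/rowP/(_ i): exy; rewrite !mxE => exy; lra.
Qed.

End HullAverage.

(** * Admissible radii *)

Section Radius.
Context (R : realType) (n : nat) (A : set 'rV[R]_n).
Local Notation H := (conv_hull A).
Local Notation B := (eunit_ball R n).

Lemma mink_avg_radius (k : nat) (r e : R) : bounded_set A -> (0 < k)%N ->
  (schneider_index A <= k%:R%:E)%E -> 0 <= r -> 0 < e ->
  (conv_hull (mink_avg A k) `<=` sum_scale (mink_avg A k) r B)%classic ->
  (conv_hull (mink_avg A k.+1) `<=`
     sum_scale (mink_avg A k.+1) ((k%:R * r + e) / k.+1%:R) B)%classic.
Proof.
move=> /bounded_sub_eunit_ball[s s0 As] k0 ck r0 e0 kr x.
have HB y : H y -> B (s^-1 *: y).
  exact: (smallest_sub (convex_set_scale_preimage (@convex_eunit_ball _ _)) As).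
move=> /(smallest_sub (@convex_conv_hull _ _ A)
  (mink_avg_sub_conv_hull (ltn0Sn k))) Hx.
(* The hull lies in [s B], so [y - x] lies in [2 s B] and [d <= e / (2 s)] puts
   the error term [d (y - x)] in [e B]. *)
have d0 : 0 < e / (s + s) by rewrite divr_gt0 ?addr_gt0.
have [d /andP[dge0 dle] [a Aa [y Hy exy]]] :=
  schneider_index_decomposition ck d0 Hx.
have [b0 Bb0 eb0] : exists2 b, B b & d *: (y - x) = e *: b.
  have ds0 : 0 <= d * s by rewrite mulr_ge0 // ltW.
  have [b Bb eb] := convex_set_scaleD (@convex_eunit_ball _ _) ds0 ds0
    (HB _ Hy) (eunit_ballN (HB _ Hx)).
  have dse : 0 <= d * s + d * s <= e.
    by rewrite addr_ge0 //= -mulrDr -ler_pdivlMr // addr_gt0.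
  have [b' Bb' eb'] := scale_eunit_ball_le dse Bb.
  exists b' => //; rewrite -eb' -eb scalerN !scalerA -scalerBr -mulrA.
  by rewrite mulfV ?mulr1 // gt_eqF.
have [z Az [b1 Bb1 ey]] : sum_scale (mink_avg A k) r B y.
  apply: kr; apply: smallest_sub Hy; first exact: convex_conv_hull.
  by move=> ? /(sub_mink_avg k0); apply: sub_gen_smallest.
have kr0 : 0 <= k%:R * r by rewrite mulr_ge0.
have [b Bb eb] := convex_set_scaleD (@convex_eunit_ball _ _) kr0 (ltW e0)
  Bb1 Bb0.
exists (k.+1%:R^-1 *: (a + k%:R *: z)); first exact: mink_avgS.
exists b => //.
have k1 : k.+1%:R != 0 :> R by rewrite pnatr_eq0.
apply: (scalerI k1); rewrite scalerDr !scalerA divff // scale1r.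
rewrite mulrC divfK // -eb -nat1r exy eb0 -ey scalerDr scalerA.
by rewrite !addrA.
Qed.

End Radius.

Theorem theorem1p3 (R : realType) (n : nat) (hn : (1 <= n)%N)
    (A : set 'rV[R]_n) (hA : compact A)
    (k : nat) (hk : (0 < k)%N) (hkc : (schneider_index A <= k%:R%:E)%E) :
  (hausdorff_to_hull (mink_avg A k.+1)
     <= (k%:R / k.+1%:R)%:E * hausdorff_to_hull (mink_avg A k))%E.
Proof.
have k0 : 0 < k%:R :> R by rewrite ltr0n.
have k1 : 0 < k.+1%:R :> R by rewrite ltr0n.
have c0 : 0 < k%:R / k.+1%:R :> R by rewrite divr_gt0.
rewrite -lee_pdivrMl //; apply: le_ereal_inf_tmp => _ [r [r0 kr] <-].
rewrite lee_pdivrMl //; apply/lee_addgt0Pr => e e0.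
apply: ereal_inf_lbound; exists ((k%:R * r + e * k.+1%:R) / k.+1%:R).
  have e1 : 0 < e * k.+1%:R by rewrite mulr_gt0.
  split; first by rewrite divr_gt0 ?addr_gt0 ?mulr_gt0.
  by apply: mink_avg_radius => //; [apply: compact_bounded|apply: ltW].
by rewrite -EFinM -EFinD mulrDl mulfK ?gt_eqF // mulrAC.
Qed.
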